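(* For all integers $c,g\ge 1$ there exist a finite set $P\subset\mathbb{R}^2$ and a finite family $\mathcal{R}$ of axis-parallel rectangles in the plane such that the hypergraph $H(P,\mathcal{R})$ is a graph (every edge has exactly two vertices), has girth at least $g$, and has chromatic number at least $c+1$.
   Context: An axis-parallel rectangle is a set $\{(x,y): x_1\le x\le x_2,\ y_1\le y\le y_2\}$ with $x_1,x_2,y_1,y_2\in\mathbb{R}$. For a point set $P$ and a family $\mathcal{F}$ of planar sets, $H(P,\mathcal{F})$ is the hypergraph with vertex set $P$ and edge set $\{P\cap F: F\in\mathcal{F}\}$. The girth of a graph is the length of its shortest cycle (infinite if it has no cycle). The chromatic number is the least number of colors in a coloring of the vertices with no monochromatic edge. *)

(* Defs.v *)
From HB Require Import structures.
From mathcomp Require Import all_boot all_order all_algebra.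
From mathcomp Require Import all_classical all_reals all_analysis.

Set Implicit Arguments.
Unset Strict Implicit.
Unset Printing Implicit Defensive.

Import Order.TTheory GRing.Theory Num.Theory.
Local Open Scope classical_set_scope.
Local Open Scope ring_scope.

Record hypergraph (T : choiceType) := Hypergraph {
  vertices : set T;
  edges : set (set T);
  edges_sub : forall e, edges e -> e `<=` vertices }.

(* Degenerate and empty rectangles are allowed. *)
Definition rectangle (R : realType) (x1 x2 y1 y2 : R) : set (R * R) :=
  [set p | x1 <= p.1 <= x2 /\ y1 <= p.2 <= y2].

Definition axis_parallel_rectangle (R : realType) : set (set (R * R)) :=
  [set F | exists x1 x2 y1 y2 : R, F = rectangle x1 x2 y1 y2].

Lemma trace_edges_sub (T : choiceType) (P : set T) (F : set (set T)) (e : set T) :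
  [set P `&` A | A in F] e -> e `<=` P.
Proof. by move=> [A _ <-] x []. Qed.

(* The hypergraph H(P, F). *)
Definition trace_hypergraph (T : choiceType) (P : set T) (F : set (set T)) :
    hypergraph T :=
  Hypergraph (@trace_edges_sub T P F).

Definition is_graph (T : choiceType) (H : hypergraph T) : Prop :=
  forall e, edges H e -> (e #= `I_2)%card.

Definition adjacent (T : choiceType) (H : hypergraph T) : rel T :=
  fun x y => `[< edges H [set x; y] >].

Definition is_cycle (T : choiceType) (H : hypergraph T) (s : seq T) : Prop :=
  (3 <= size s)%N /\ ucycle (adjacent H) s.

(* ereal_inf set0 = +oo, so acyclic graphs have infinite girth. *)
Definition girth (R : realType) (T : choiceType) (H : hypergraph T) : \bar R :=
  ereal_inf [set ((size s)%:R)%:E | s in is_cycle H].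

Definition monochromatic (T : choiceType) (f : T -> nat) (e : set T) : Prop :=
  exists i, forall x, e x -> f x = i.

(* The colors are 0, ..., k - 1; values of f outside the vertex set are
   irrelevant. *)
Definition proper_coloring (T : choiceType) (H : hypergraph T) (k : nat)
    (f : T -> nat) : Prop :=
  (forall x, vertices H x -> (f x < k)%N) /\
  (forall e, edges H e -> ~ monochromatic f e).

Definition chromatic_number (R : realType) (T : choiceType) (H : hypergraph T) :
    \bar R :=
  ereal_inf [set (k%:R)%:E | k in [set k : nat | exists f, proper_coloring H k f]].

(* Main.v *)
(* The proof is an induction on the number of colors along Tutte's construction.
   Given a graph G on n points that is not k-colorable, take an n-uniform
   hypergraph of large girth that is not (k + 1)-colorable, and join by a perfect
   matching each of its edges to a private copy of G. In a (k + 1)-coloring some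
   edge of the hypergraph is monochromatic, and the copy of G attached to it has
   to avoid that color or to contain a monochromatic matching edge. Only the order
   of the coordinates matters for a rectangle to be empty, so the copies can be
   stretched vertically to put every point right next to its match. The
   hypergraphs come from the partite construction of Nesetril and Rodl. *)

Require Import Defs.
From HB Require Import structures.
From mathcomp Require Import all_boot zify.

Set Implicit Arguments.
Unset Strict Implicit.
Unset Printing Implicit Defensive.

(** * Girth through leafless sets of incidences *)

Section Incidence.
Variables V E : finType.
Implicit Types (S : {set V * E}) (I : V -> E -> Prop).

Definition other_edge S p := exists q, [/\ q \in S, q.1 = p.1 & q.2 <> p.2].
Definition other_vertex S p := exists q, [/\ q \in S, q.2 = p.2 & q.1 <> p.1].

Definition leafless S :=
  forall p, p \in S -> other_edge S p /\ other_vertex S p.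

(* No nonempty set of fewer than [g] incidences is leafless: since every cycle of
   the incidence graph is leafless, that graph has girth at least [g], and a
   cycle of length [n] of the hypergraph accounts for [2 n] incidences. *)
Definition girth_ge (g : nat) I :=
  forall S, (forall p, p \in S -> I p.1 p.2) -> leafless S -> #|S| < g ->
  S = set0.

Lemma girth_geW g g' I : g <= g' -> girth_ge g' I -> girth_ge g I.
Proof. by move=> le_gg' H S SI Sl Sg; apply: H => //; apply: leq_trans le_gg'. Qed.

(* A forest with at most one leaf [z] is empty: deleting a leaf moves the
   exception to its neighbour. *)
Lemma one_leaf_empty g I S (z : V + E) :
  girth_ge g I -> (forall p, p \in S -> I p.1 p.2) -> #|S| < g ->
  (forall p, p \in S -> inl p.1 <> z -> other_edge S p) ->
  (forall p, p \in S -> inr p.2 <> z -> other_vertex S p) ->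
  S = set0.
Proof.
move=> HI; have [n] := ubnP #|S|; elim: n S z => // n IHn S z ltSn SI Sg HV HE.
apply/eqP/negP => /negP S0.
have IHp p z' : p \in S ->
    (forall r, r \in S :\ p -> inl r.1 <> z' -> other_edge (S :\ p) r) ->
    (forall r, r \in S :\ p -> inr r.2 <> z' -> other_vertex (S :\ p) r) ->
    S = [set p].
  move=> pS HV' HE'.
  suff S'0 : S :\ p = set0 by rewrite -(setD1K pS) S'0 setU0.
  have cS : #|S| = #|S :\ p|.+1 by rewrite (cardsD1 p) pS.
  by apply: (IHn _ z') => //; [lia | move=> q /setD1P[_ /SI] | lia].
have [Vok|] := boolP [forall p in S, exists q in S, (q.1 == p.1) && (q.2 != p.2)].
  have [Eok|] := boolP [forall p in S, exists q in S, (q.2 == p.2) && (q.1 != p.1)].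
    apply/(negP S0)/eqP/HI => // p pS; split.
      move/forall_inP/(_ p pS)/exists_inP : Vok => [q qS /andP[/eqP q1 /eqP q2]].
      by exists q.
    move/forall_inP/(_ p pS)/exists_inP : Eok => [q qS /andP[/eqP q1 /eqP q2]].
    by exists q.
  rewrite negb_forall_in => /exists_inP[p pS].
  rewrite negb_exists_in => /forall_inP pl.
  have {}pl q : q \in S -> q.2 = p.2 -> q.1 = p.1.
    by move=> /pl; rewrite negb_and negbK => /orP[/eqP//|/eqP].
  have zp : z = inr p.2.
    case: (eqVneq z (inr p.2)) => // /eqP zp.
    by have [|q [qS /(pl _ qS)]] := HE p pS; first exact: nesym.
  have Sp : S = [set p].
    apply: (IHp p (inl p.1)) => // r /setD1P[rp rS] rz.
      have [|q [qS q1 q2]] := HV r rS; first by rewrite zp.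
      exists q; split=> //; apply/setD1P; split=> //.
      by apply/eqP => qp; apply: rz; rewrite -q1 qp.
    have rp2 : r.2 <> p.2.
      move=> rp2; move/eqP: rp; apply.
      by rewrite [r]surjective_pairing [p]surjective_pairing (pl r rS rp2) rp2.
    have [|q [qS q1 q2]] := HE r rS; first by rewrite zp => -[].
    exists q; split=> //; apply/setD1P; split=> //; apply/eqP => qp.
    by apply: rp2; rewrite -q1 qp.
  (* Now [S] is a single incidence: its vertex and its edge are both leaves, but only the edge is
     [z]. *)
  have [|q []] := HV p pS; first by rewrite zp.
  by rewrite Sp => /set1P->.
rewrite negb_forall_in => /exists_inP[p pS].
rewrite negb_exists_in => /forall_inP pl.
have {}pl q : q \in S -> q.1 = p.1 -> q.2 = p.2.
  by move=> /pl; rewrite negb_and negbK => /orP[/eqP//|/eqP].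
have zp : z = inl p.1.
  case: (eqVneq z (inl p.1)) => // /eqP zp.
  by have [|q [qS /(pl _ qS)]] := HV p pS; first exact: nesym.
have Sp : S = [set p].
  apply: (IHp p (inr p.2)) => // r /setD1P[rp rS] rz.
    have rp1 : r.1 <> p.1.
      move=> rp1; move/eqP: rp; apply.
      by rewrite [r]surjective_pairing [p]surjective_pairing (pl r rS rp1) rp1.
    have [|q [qS q1 q2]] := HV r rS; first by rewrite zp => -[].
    exists q; split=> //; apply/setD1P; split=> //; apply/eqP => qp.
    by apply: rp1; rewrite -q1 qp.
  have [|q [qS q1 q2]] := HE r rS; first by rewrite zp.
  exists q; split=> //; apply/setD1P; split=> //.
  by apply/eqP => qp; apply: rz; rewrite -q1 qp.
have [|q []] := HE p pS; first by rewrite zp.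
by rewrite Sp => /set1P->.
Qed.

End Incidence.

(** A leafless set pulls back along [a] and [b] to a leafless set of the same size, since every
    incidence of [I] lifts. *)
Lemma girth_ge_image (V E V' E' : finType) (a : V' -> V) (b : E' -> E) g
    (I : V -> E -> Prop) (I' : V' -> E' -> Prop) :
  injective a -> injective b ->
  (forall v e, I v e -> exists v' e', [/\ v = a v', e = b e' & I' v' e']) ->
  girth_ge g I' -> girth_ge g I.
Proof.
move=> inja injb II' HI' S SI Sl Sg.
pose ab (p : V' * E') := (a p.1, b p.2).
have injab : injective ab by move=> [v e] [v' e'] [/inja-> /injb->].
have Sim p : p \in S -> exists2 p', ab p' = p & I' p'.1 p'.2.
  case: p => v e /SI /= /II'[v' [e' [-> -> vI]]]; by exists (v', e').
have SE : S = ab @: (ab @^-1: S).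
  apply/setP => p; apply/idP/imsetP => [pS|[q]]; last by rewrite inE => qS ->.
  by have [q qp _] := Sim p pS; exists q => //; rewrite inE qp.
rewrite SE; suff -> : ab @^-1: S = set0 by rewrite imset0.
apply: HI' => [p|p|]; last by move: Sg; rewrite {1}SE card_imset.
  by rewrite inE => /Sim[q /injab ->].
rewrite inE => pS; have [[q [qS q1 q2]] [r [rS r1 r2]]] := Sl _ pS.
split.
  have [s sq _] := Sim q qS; exists s; rewrite inE sq; split=> //.
    by apply: inja; move: q1; rewrite -sq.
  by move=> sp; apply: q2; rewrite -sq /= sp.
have [s sr _] := Sim r rS; exists s; rewrite inE sr; split=> //.
  by apply: injb; move: r1; rewrite -sr.
by move=> sp; apply: r2; rewrite -sr /= sp.
Qed.

(* [kappa e] is the copy in which the edge [e] lies, and [I0] records which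
   vertices each copy shares with the others. The doubling comes from the third
   hypothesis: a walk in one copy needs two edges to join two shared vertices. *)
Lemma girth_ge_amalgam (V E E0 : finType) (kappa : E -> E0) g
    (I : V -> E -> Prop) (I0 : V -> E0 -> Prop) :
  (forall c, girth_ge g.*2 (fun v e => I v e /\ kappa e = c)) ->
  (forall v e e', I v e -> I v e' -> kappa e <> kappa e' -> I0 v (kappa e)) ->
  (forall e v v', I v e -> I v' e -> I0 v (kappa e) -> I0 v' (kappa e) ->
    v = v') ->
  girth_ge g I0 -> girth_ge g.*2 I.
Proof.
move=> Icopy Ishared Ione HI0 S SI Sl Sg.
(* [S1] collects the incidences where [S] passes from one copy to another. Its [shadow] will be a
   leafless set for [I0] of at most half the size of [S]. *)
pose S1 := [set p in S | [exists q in S, (q.1 == p.1) && (kappa q.2 != kappa p.2)]].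
pose shadow (p : V * E) := (p.1, kappa p.2).
have S1P p : p \in S1 -> p \in S /\ I0 p.1 (kappa p.2).
  rewrite inE => /andP[pS /exists_inP[q qS /andP[/eqP q1 /eqP q2]]]; split=> //.
  by apply: (Ishared p.1 p.2 q.2) => //; [exact: SI | rewrite -q1; exact: SI |
    exact: nesym].
have S1n p q : p \in S -> p \notin S1 -> q \in S -> q.1 = p.1 ->
    kappa q.2 = kappa p.2.
  move=> pS pS1 qS qp; apply/eqP; apply: contraR pS1 => pq.
  by rewrite inE pS; apply/exists_inP; exists q; rewrite ?qp ?eqxx.
(* If the part of [S] in copy [c] touches other copies at most at [z], it has at most one leaf and
   [one_leaf_empty] applies. *)
have copy0 c (z : V + E) :
    (forall p, p \in S -> kappa p.2 = c -> inl p.1 <> z -> p \notin S1) ->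
    (forall e, inr e <> z) ->
    [set p in S | kappa p.2 == c] = set0.
  move=> zS1 zV; apply: (one_leaf_empty (z := z) (Icopy c)) => [p|||].
  - by rewrite inE => /andP[/SI pI /eqP].
  - apply: leq_ltn_trans Sg; apply/subset_leq_card/subsetP => p.
    by rewrite inE => /andP[].
  - move=> p; rewrite inE => /andP[pS /eqP pc] pz.
    have [[q [qS q1 q2]] _] := Sl p pS; exists q; split=> //.
    by rewrite inE qS -pc; apply/eqP/S1n => //; exact: zS1.
  - move=> p; rewrite inE => /andP[pS /eqP pc] pz.
    have [_ [q [qS q1 q2]]] := Sl p pS; exists q; split=> //.
    by rewrite inE qS q1 pc eqxx.
(* [h] moves an incidence to another vertex of the same edge. By [Ione] an edge has at most one
   shared vertex, so [h] maps [S1] injectively outside [S1]. *)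
have cardS1 : #|S1|.*2 <= #|S|.
  pose h p := odflt p [pick q in S | (q.2 == p.2) && (q.1 != p.1)].
  have hP p : p \in S -> [/\ h p \in S, (h p).2 = p.2 & (h p).1 <> p.1].
    move=> pS; rewrite /h; case: pickP => [q /and3P[qS /eqP q1 /eqP q2]//|] hp.
    have [_ [q [qS q1 q2]]] := Sl p pS.
    by have /negP[] := hp q; rewrite qS q1 eqxx; apply/eqP.
  have hinj : {in S1 &, injective h}.
    move=> p q /S1P[pS pI] /S1P[qS qI] hpq.
    have [_ hp2 _] := hP p pS; have [_ hq2 _] := hP q qS.
    have pq2 : p.2 = q.2 by rewrite -hp2 hpq.
    rewrite [p]surjective_pairing [q]surjective_pairing pq2; congr pair.
    apply: (Ione q.2); rewrite -?pq2 //; [exact: SI | | by rewrite pq2].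
    by rewrite pq2; exact: SI.
  have hS1 : h @: S1 \subset S :\: S1.
    apply/subsetP => _ /imsetP[p pS1 ->]; have [pS pI] := S1P p pS1.
    have [hS h2 h1] := hP p pS; rewrite inE hS andbT.
    apply/negP => /S1P[_ hI]; apply: h1; apply: (Ione p.2); rewrite -?h2 //.
    - exact: SI.
    - by rewrite h2; apply: SI.
    - by rewrite h2.
  have := subset_leq_card hS1; rewrite card_in_imset // cardsD.
  have /setIidPr -> : S1 \subset S by apply/subsetP => p /S1P[].
  have S1S : #|S1| <= #|S| by apply/subset_leq_card/subsetP => p /S1P[].
  by rewrite leq_subRL // addnn.
have T0 : shadow @: S1 = set0.
  apply: HI0.
  - by move=> _ /imsetP[p /S1P[pS pI] ->].
  - move=> _ /imsetP[p pS1 ->]; have [pS pI] := S1P p pS1; split.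
      move: (pS1); rewrite inE pS => /exists_inP[q qS /andP[/eqP q1 q2]].
      exists (shadow q); split=> //; last exact/eqP.
      apply: imset_f; rewrite inE qS; apply/exists_inP; exists p => //.
      by rewrite q1 eqxx eq_sym.
    have [/existsP[q /and3P[qS1 /eqP qk /eqP q1]]|nq] := boolP [exists q,
        [&& q \in S1, kappa q.2 == kappa p.2 & q.1 != p.1]].
      by exists (shadow q); split=> //; exact: imset_f.
    (* With no such [q], [S] leaves this copy at [p.1] only, so [copy0] makes it empty although it
       contains [p]. *)
    have : p \in [set p0 in S | kappa p0.2 == kappa p.2] by rewrite inE pS eqxx.
    rewrite (copy0 _ (inl p.1)) ?inE // => q qS qk qp; apply/negP => qS1.
    move/existsP: nq; apply; exists q; rewrite qS1 qk eqxx /=.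
    by apply/eqP => e; apply: qp; rewrite e.
  - apply: leq_ltn_trans (leq_imset_card _ _) _.
    by rewrite -ltn_double; exact: leq_ltn_trans cardS1 Sg.
have {}T0 p : p \notin S1.
  by apply/negP => /(imset_f shadow); rewrite T0 inE.
apply/setP => p; rewrite inE; apply/negP => pS.
have : p \in [set p0 in S | kappa p0.2 == kappa p.2] by rewrite inE pS eqxx.
by rewrite (copy0 _ (inl p.1)) ?inE.
Qed.

(* A hypergraph whose edges have uniform size is given by its edges
   [phi e : N -> V], injectively labelled by a finite type [N]. *)
Definition incident (N V E : finType) (phi : E -> N -> V) (v : V) (e : E) : Prop :=
  exists j, phi e j = v.

Definition not_colorable (N V E : finType) (k : nat) (phi : E -> N -> V) : Prop :=
  forall f : V -> 'I_k, exists e i, forall j, f (phi e j) = i.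

(** * Complete uniform hypergraphs *)

Section CompleteHypergraph.
Variables (N : finType) (k : nat).

(** One point more than the pigeonhole principle allows if all [k.+1] color classes had at most
    [#|N|] points. *)
Definition ground := 'I_(k.+1 * #|N|).+1.
Definition injection := {e : {ffun N -> ground} | injectiveb e}.
Definition injection_fun (e : injection) : N -> ground := val e.

Lemma injection_fun_inj e : injective (injection_fun e).
Proof. exact/injectiveP/(valP e). Qed.

Lemma complete_not_colorable : not_colorable k.+1 injection_fun.
Proof.
move=> f.
have [i iN] : exists i : 'I_k.+1, #|N| <= #|[set a | f a == i]|.
  apply/existsP; apply: contraT; rewrite negb_exists => /forallP small.
  have : #|ground| <= k.+1 * #|N|.
    rewrite -sum1_card (partition_big f xpredT) //=.
    rewrite -[X in _ <= X * _]card_ord -sum_nat_const; apply: leq_sum => i _.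
    rewrite sum1_card; have := small i; rewrite -ltnNge => /ltnW.
    by apply: leq_trans; apply: eq_leq; apply: eq_card => a; rewrite !inE.
  by rewrite card_ord ltnn.
pose e := [ffun j : N => enum_val (widen_ord iN (enum_rank j))].
have einj : injectiveb e.
  apply/injectiveP => j j'; rewrite !ffunE => /enum_val_inj/(congr1 val) /= jj'.
  exact/enum_rank_inj/val_inj.
exists (Sub e einj : injection), i => j; rewrite /injection_fun SubK ffunE.
by have := enum_valP (widen_ord iN (enum_rank j)); rewrite inE => /eqP.
Qed.

End CompleteHypergraph.

(** * Amalgamation of partite hypergraphs along one part *)

Section Amalgam.
Variables (N A V E V' E' : finType) (i : A) (pi : V -> A).
Variables (phi : E -> N -> V) (phi' : E' -> {v | pi v == i} -> V').

(** Part [i] of copy [c] is glued onto the edge [c] of [phi']; the other vertices stay private. *)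
Definition copy_vertex (c : E') (v : V) : V' + E' * V :=
  if insub v is Some u then inl (phi' c u) else inr (c, v).

Definition amalgam (e : E' * E) (j : N) : V' + E' * V :=
  copy_vertex e.1 (phi e.2 j).

Definition amalgam_part (v : V' + E' * V) : A :=
  match v with inl _ => i | inr (_, v) => pi v end.

Lemma copy_vertexT c v (h : pi v == i) :
  copy_vertex c v = inl (phi' c (exist _ v h)).
Proof. by rewrite /copy_vertex insubT. Qed.

Lemma copy_vertexF c v : pi v != i -> copy_vertex c v = inr (c, v).
Proof. by move=> /negPf h; rewrite /copy_vertex insubF. Qed.

Lemma amalgam_partE c v : amalgam_part (copy_vertex c v) = pi v.
Proof.
case: (boolP (pi v == i)) => h; last by rewrite copy_vertexF.
by rewrite copy_vertexT (eqP h).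
Qed.

Hypothesis phi'_inj : forall e, injective (phi' e).

Lemma copy_vertex_inj c : injective (copy_vertex c).
Proof.
move=> v w; case: (boolP (pi v == i)) => hv; case: (boolP (pi w == i)) => hw.
- by rewrite !copy_vertexT => -[/phi'_inj[]].
- by rewrite copy_vertexT copy_vertexF.
- by rewrite copy_vertexF // copy_vertexT.
- by rewrite !copy_vertexF // => -[].
Qed.

Lemma copy_vertex_inl c v u : copy_vertex c v = inl u ->
  pi v = i /\ incident phi' u c.
Proof.
case: (boolP (pi v == i)) => h; last by rewrite copy_vertexF.
by rewrite copy_vertexT => -[<-]; split; [exact/eqP | eexists].
Qed.

Lemma copy_vertex_inr c v d w : copy_vertex c v = inr (d, w) -> c = d.
Proof.
case: (boolP (pi v == i)) => h; first by rewrite copy_vertexT.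
by rewrite copy_vertexF // => -[].
Qed.

(** Copies meet only in part [i], where an edge transversal to the parts has at most one vertex, as
    [girth_ge_amalgam] requires. *)
Lemma amalgam_girth g :
  (forall e, injective (pi \o phi e)) ->
  girth_ge g.*2 (incident phi) -> girth_ge g (incident phi') ->
  girth_ge g.*2 (incident amalgam).
Proof.
move=> transv Hphi Hphi'.
apply: (@girth_ge_amalgam _ _ _ fst _ _
  (fun v c => exists2 u, v = inl u & incident phi' u c)).
- move=> c; apply: (girth_ge_image (@copy_vertex_inj c) (b := pair c) _ _ Hphi).
    by move=> e e' [].
  move=> v [c' e] [[j <-] /= ->]; exists (phi e j), e; split=> //; by exists j.
- move=> v [c e] [c' e'] /= [j <-] [j' /= vE] cc'; rewrite /amalgam /= in vE *.
  case vE': (copy_vertex c (phi e j)) => [u|[d w]].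
    by exists u => //; have [] := copy_vertex_inl vE'.
  rewrite vE' in vE; case: cc'.
  by rewrite (copy_vertex_inr vE) (copy_vertex_inr vE').
- move=> [c e] _ _ [j <-] [j' <-] [u uE _] [u' uE' _].
  have [/= pj _] := copy_vertex_inl uE; have [/= pj' _] := copy_vertex_inl uE'.
  by congr amalgam; apply: (transv e); rewrite /= pj.
- apply: (girth_ge_image (a := inl) (b := id) _ _ _ Hphi') => //.
    by move=> u u' [].
  by move=> v c [u -> uc]; exists u, c.
Qed.

End Amalgam.

(** * The partite construction *)

Section PartiteConstruction.
Variables (N : finType) (k g : nat).
Hypothesis IHg : forall M : finType, exists (V E : finType) (phi : E -> M -> V),
  [/\ forall e, injective (phi e), girth_ge g (incident phi) &
      not_colorable k.+1 phi].

Let A := ground N k.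
Let E0 := injection N k.

(* Amalgamating copies along one part makes that part monochromatic in some copy;
   once this is done for all parts, [gamma] colors the complete hypergraph on the
   set of parts. *)
Lemma partite_construction (D : seq A) :
  exists (V E : finType) (phi : E -> N -> V) (pi : V -> A) (tau : E -> E0),
  [/\ forall e j, pi (phi e j) = injection_fun (tau e) j,
      girth_ge g.*2 (incident phi) &
      forall f : V -> 'I_k.+1, exists (s : E0 -> E) (gamma : A -> 'I_k.+1),
        forall e0, tau (s e0) = e0 /\
          forall j, injection_fun e0 j \in D ->
            f (phi (s e0) j) = gamma (injection_fun e0 j)].
Proof.
elim: D => [|i D [V [E [phi [pi [tau [tauP Hphi col]]]]]]].
  (* The edges are made disjoint, so each vertex lies on one edge only and no nonempty set is
     leafless. *)
  exists (E0 * N)%type, E0, (fun e j => (e, j)),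
    (fun v => injection_fun v.1 v.2), id; split=> //.
    move=> S SI Sl _; apply/setP => p; rewrite inE; apply/negP => pS.
    have [[q [qS qp1 qp2]] _] := Sl p pS; apply: qp2.
    have [j p1] := SI _ pS; have [j' q1] := SI _ qS.
    by move: qp1; rewrite -p1 -q1 => -[].
  by move=> f; exists id, (fun=> ord0).
have [V' [E' [phi' [phi'_inj Hphi' col']]]] := IHg {v | pi v == i}.
exists (V' + E' * V)%type, (E' * E)%type, (amalgam phi phi'),
  (@amalgam_part _ _ _ _ i pi), (fun e => tau e.2); split.
- by move=> [c e] j; rewrite amalgam_partE tauP.
- apply: amalgam_girth => // e j j' /=; rewrite !tauP; exact: injection_fun_inj.
- move=> f; have [c [x cx]] := col' (f \o inl).
  have [s [gamma sP]] := col (f \o copy_vertex phi' c).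
  (* The edge [c] is monochromatic, so copy [c] has color [x] on all of part [i]; inside this copy
     the induction hypothesis handles the parts in [D]. *)
  exists (fun e0 => (c, s e0)), (fun a => if a == i then x else gamma a) => e0.
  have [ts sD] := sP e0; split=> // j; rewrite inE /amalgam /=.
  have [e0j _|e0j /= /sD //] := eqVneq.
  have h : pi (phi (s e0) j) == i by rewrite tauP ts e0j.
  by rewrite copy_vertexT; exact: cx.
Qed.

End PartiteConstruction.

(* The Erdos-Hajnal theorem, by the partite construction of Nesetril and Rodl. *)
Lemma high_girth_hypergraph (k g : nat) (N : finType) :
  exists (V E : finType) (phi : E -> N -> V),
  [/\ forall e, injective (phi e), girth_ge g (incident phi) &
      not_colorable k.+1 phi].
Proof.
suff [V [E [phi [phi_inj Hphi col]]]] : exists (V E : finType) (phi : E -> N -> V),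
  [/\ forall e, injective (phi e), girth_ge (2 ^ g) (incident phi) &
      not_colorable k.+1 phi].
  exists V, E, phi; split=> //; apply: girth_geW Hphi; exact/ltnW/ltn_expl.
(* Each round doubles the girth. [N] stays general because the glued hypergraphs have edges as large
   as the parts. *)
elim: g N => [|g IHg] N.
  exists (ground N k), (injection N k), (@injection_fun N k); split.
  - exact: injection_fun_inj.
  - by move=> S _ _; rewrite ltnS leqn0 cards_eq0 => /eqP.
  - exact: complete_not_colorable.
have [V [E [phi [pi [tau [tauP Hphi col]]]]]] :=
  partite_construction IHg (enum (ground N k)).
exists V, E, phi; split.
- by move=> e j j' /(congr1 pi); rewrite !tauP; apply: injection_fun_inj.
- by rewrite expnS mul2n.
- move=> f; have [s [gamma sP]] := col f.
  have [e0 [x e0x]] := complete_not_colorable gamma.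
  exists (s e0), x => j; rewrite -(e0x j).
  by have [_ ->] := sP e0; rewrite // mem_enum.
Qed.

(** * Tutte's construction with boxes *)

Lemma increasing_relabelling (W : finType) (y z : W -> nat) :
  injective y -> injective z ->
  exists s : W -> W, forall w w', y w < y w' -> z (s w) < z (s w').
Proof.
move=> yinj zinj.
pose r (h : W -> nat) := relpre h leq.
have rtr h : transitive (r h) by move=> a b c; exact: leq_trans.
have rtot h : total (r h) by move=> a b; exact: leq_total.
have rrefl h : reflexive (r h) by move=> a; exact: leqnn.
pose sy := sort (r y) (enum W); pose sz := sort (r z) (enum W).
have sizeE : size sy = size sz by rewrite !size_sort.
have memE w : w \in sy by rewrite mem_sort mem_enum.
have uz : uniq sz by rewrite sort_uniq enum_uniq.
(* [s] matches elements of equal rank in the two orders. *)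
pose s w := nth w sz (index w sy).
have idx w : index w sy < size sz by rewrite -sizeE index_mem.
have sE w0 w : s w = nth w0 sz (index w sy) by exact: set_nth_default.
have sinj : injective s.
  move=> w w'; rewrite (sE w w) (sE w w') => /eqP; rewrite nth_uniq // => /eqP ii.
  by rewrite -(nth_index w (memE w)) ii nth_index.
exists s => w w' yw.
have ltidx : index w sy < index w' sy.
  rewrite ltnNge; apply/negP => le.
  have := @sorted_leq_index _ (r y) (rtr y) (rrefl y) sy (sort_sorted (rtot y) _)
    w' w (memE w') (memE w) le.
  by rewrite /= leqNgt yw.
have lez : z (s w) <= z (s w').
  rewrite (sE w w) (sE w w').
  apply: (@sorted_leq_nth _ (r z) (rtr z) (rrefl z) w sz (sort_sorted (rtot z) _));
    by rewrite ?inE // ltnW.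
rewrite ltn_neqAle lez andbT; apply/eqP => /zinj/sinj ww'.
by rewrite ww' ltnn in yw.
Qed.

Definition in_box (W : Type) (x y : W -> nat) (p q w : W) : bool :=
  (minn (x p) (x q) <= x w <= maxn (x p) (x q)) &&
  (minn (y p) (y q) <= y w <= maxn (y p) (y q)).

(* One copy of the graph [phi] per edge [c] of the hypergraph [psi], each vertex
   of the copy being joined to one vertex of [c]. The vertices of [psi] lie on
   the line [x = 0]; the copies occupy disjoint vertical strips, and the points
   joined to a vertex [v] lie just above the height of [v], lower and lower as
   the strips move right, so that they do not block one another. *)
Section GeometricStep.
Variables (W E V E' : finType) (phi : E -> bool -> W) (psi : E' -> W -> V).
Variables (x y : W -> nat) (height : V -> nat) (strip : E' -> nat) (m n : nat).

Definition tutte_vertex : finType := (V + E' * W)%type.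
Definition tutte_edge : finType := (E' * (E + W))%type.

Definition tutte_graph (e : tutte_edge) (b : bool) : tutte_vertex :=
  match e with
  | (c, inl e) => inr (c, phi e b)
  | (c, inr w) => if b then inl (psi c w) else inr (c, w)
  end.

Definition tutte_x (p : tutte_vertex) : nat :=
  match p with
  | inl _ => 0
  | inr (c, w) => 1 + (strip c * m + x w)
  end.

(** Each vertex of [psi] owns a block of [n.+1] rows and takes the lowest. As [strip c < n], the
    offset [n - strip c] is positive and stays inside the block. *)
Definition tutte_y (p : tutte_vertex) : nat :=
  match p with
  | inl v => height v * n.+1
  | inr (c, w) => height (psi c w) * n.+1 + (n - strip c)
  end.

Hypothesis x_lt : forall w, x w < m.
Hypothesis strip_lt : forall c, strip c < n.
Hypothesis height_inj : injective height.
Hypothesis strip_inj : injective strip.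
Hypothesis phi_inj : forall e, injective (phi e).
Hypothesis psi_inj : forall c, injective (psi c).

Lemma tutte_graph_inj e : injective (tutte_graph e).
Proof.
case: e => c [e|w] /= b b'; first by case=> /phi_inj.
by case: b; case: b'.
Qed.

Lemma tutte_y_inj : injective tutte_y.
Proof.
have eqM a b r s : r < n.+1 -> s < n.+1 ->
    a * n.+1 + r = b * n.+1 + s -> a = b /\ r = s.
  move=> rM sM abE; have ab : a = b by nia.
  by split=> //; move: abE; rewrite ab => /addnI.
move=> [v|[c w]] [v'|[c' w']] /=.
- by move/eqP; rewrite eqn_pmul2r // => /eqP/height_inj->.
- by rewrite -[X in X = _]addn0; have c1 := strip_lt c' => /eqM[|| _ h]; lia.
- by rewrite -[X in _ = X]addn0; have c1 := strip_lt c => /eqM[|| _ h]; lia.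
- have c1 := strip_lt c; have c2 := strip_lt c'.
  move=> /eqM[||/height_inj ww' cc']; [lia|lia|].
  have {}cc' : c = c' by apply/strip_inj; lia.
  by move: ww'; rewrite cc' => /psi_inj->.
Qed.

Hypothesis psi_incr : forall c w w', y w < y w' ->
  height (psi c w) < height (psi c w').
Hypothesis phi_box : forall e w,
  in_box x y (phi e true) (phi e false) w -> incident phi w e.

Lemma tutte_graph_box e p :
  in_box tutte_x tutte_y (tutte_graph e true) (tutte_graph e false) p ->
  incident tutte_graph p e.
Proof.
case: e => c [e|w].
  case: p => [v|[c' w']]; first by rewrite /in_box /=; lia.
  rewrite /in_box /= => /andP[xB yB].
  have x0 := x_lt w'; have x1 := x_lt (phi e true).
  have x2 := x_lt (phi e false).
  have cc' : c' = c by apply/strip_inj; nia.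
  subst c'.
  suff [b <-] : incident phi w' e by exists b.
  apply: phi_box; apply/andP; split; first lia.
  (* By [psi_incr] the vertical order inside the copy is that of [y], so the box pulls back to a box
     of [phi]. *)
  have t1 := @psi_incr c (phi e true) w'; have t2 := @psi_incr c w' (phi e true).
  have f1 := @psi_incr c (phi e false) w'; have f2 := @psi_incr c w' (phi e false).
  move: yB; rewrite -addn_minl -addn_maxl !leq_add2r -minnMl -maxnMl !leq_pmul2r //.
  lia.
case: p => [v|[c' w']]; rewrite /in_box /= => /andP[xB yB].
  have c1 := strip_lt c.
  by exists true; congr inl; apply/height_inj; nia.
have c1 := strip_lt c; have c2 := strip_lt c'.
have rr : height (psi c' w') = height (psi c w) by nia.
have x1 := x_lt w; have x2 := x_lt w'.
(* The abscissas give [strip c' <= strip c]. Within one block the offsets decrease with the strip,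
   which gives the converse. *)
have cc' : c' = c by apply/strip_inj; rewrite rr in yB; nia.
subst c'; exists false; congr (inr (_, _)).
exact/(@psi_inj c)/height_inj.
Qed.

Lemma tutte_not_colorable k :
  not_colorable k phi -> not_colorable k.+1 psi -> not_colorable k.+1 tutte_graph.
Proof.
move=> phi_col psi_col f; have [c [i ci]] := psi_col (f \o inl).
have [/existsP[w /eqP wi]|ni] := boolP [exists w, f (inr (c, w)) == i].
  by exists (c, inr w), i => -[] //=; exact: ci.
(* Color [i] is absent from copy [c], so [lift i] turns its coloring into one by ['I_k]. *)
have lf w : {j | f (inr (c, w)) = lift i j}.
  have /unlift_some[j -> _] : i != f (inr (c, w)).
    by rewrite eq_sym; apply: contra ni => h; apply/existsP; exists w.
  by exists j.
have [e [j ej]] := phi_col (fun w => sval (lf w)).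
exists (c, inl e), (lift i j) => b /=.
by rewrite (svalP (lf (phi e b))) ej.
Qed.

(** The copies with their matching edges are amalgamated at the vertices of [psi], of which an edge
    contains at most one. *)
Lemma tutte_girth g :
  girth_ge g.*2 (incident phi) -> girth_ge g (incident psi) ->
  girth_ge g.*2 (incident tutte_graph).
Proof.
move=> Hphi Hpsi.
apply: (@girth_ge_amalgam _ _ _ fst _ _
  (fun v c => exists2 u, v = inl u & incident psi u c)).
- move=> c S SI Sl Sg.
  (* Matching edges are pendant inside copy [c]: as [psi c] is injective, only one of them reaches
     [psi c w]. *)
  have nopend p w : p \in S -> p.2 <> (c, inr w).
    move=> pS pw.
    have [q [qS q1 q2]] : exists q,
        [/\ q \in S, q.1 = inl (psi c w) & q.2 = (c, inr w)].
      have [_ [q [qS q2 q1]]] := Sl p pS.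
      have [[b pb] _] := SI p pS; have [[b' qb] _] := SI q qS.
      rewrite q2 pw /= in qb; rewrite pw /= in pb.
      case: b b' pb qb => -[] pb qb.
      - by rewrite -pb -qb in q1.
      - by exists p.
      - by exists q; rewrite q2 pw.
      - by rewrite -pb -qb in q1.
    have [[r [rS r1 r2]] _] := Sl q qS; rewrite q1 q2 in r1 r2.
    have [[b rb] rc] := SI r rS.
    case: r rS r1 r2 rb rc => rv [d [e|w']] /= rS r1 r2 rb dc.
      by rewrite -rb in r1.
    move: rb; rewrite r1 dc; case: b => // -[/psi_inj ww'].
    by apply: r2; rewrite dc ww'.
  pose I (v : tutte_vertex) (e : tutte_edge) := exists w e',
    [/\ v = inr (c, w), e = (c, inl e') & incident phi w e'].
  suff : girth_ge g.*2 I.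
    apply=> // -[v [d [e|w]]] pS; last first.
      have [_ /= dc] := SI _ pS; rewrite dc in pS.
      by case: (nopend _ w pS).
    have [/= [b <-] ->] := SI _ pS.
    by exists (phi e b), e; split=> //; exists b.
  apply: (girth_ge_image (a := fun w => inr (c, w))
    (b := fun e => (c, inl e)) _ _ _ Hphi) => //.
  + by move=> w w' [].
  + by move=> e e' [].
- move=> v [c [e|w]] [c' [e'|w']] [b <-] /= [b' vE] cc'.
  + by case: vE => /esym.
  + by case: b' vE => // -[/esym].
  + by case: b vE => // -[/esym].
  + case: b vE => /=; last by case: b' => // -[/esym].
    by exists (psi c w) => //; exists w.
- move=> [c [e|w]] _ _ [b <-] [b' <-] [u //= uE _] [u' //= uE' _].
  by case: b uE; case: b' uE'.
- apply: (girth_ge_image (a := inl) (b := id) _ _ _ Hpsi) => //.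
    by move=> u u' [].
  by move=> v c [u -> uc]; exists u, c.
Qed.

End GeometricStep.

(** Injectivity of [y] is carried along: the next step sorts the copies by height, and in the plane
    it keeps the points distinct. *)
Lemma high_girth_box_graph (k g : nat) :
  exists (W E : finType) (phi : E -> bool -> W) (x y : W -> nat),
  [/\ forall e, injective (phi e), injective y,
      forall e w, in_box x y (phi e true) (phi e false) w -> incident phi w e,
      girth_ge g.*2 (incident phi) & not_colorable k phi].
Proof.
elim: k => [|k [W [E [phi [x [y [phi_inj y_inj phi_box Hphi phi_col]]]]]]].
  exists unit, void, (fun (e : void) _ => match e with end), (fun=> 0), (fun=> 0).
  split.
  - by case.
  - by case; case.
  - by case.
  - by move=> S _ _ _; apply/setP => -[_ []].
  - by move=> f; case: (f tt).
have [V [E' [psi [psi_inj Hpsi psi_col]]]] := high_girth_hypergraph k g W.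
(* Each edge of [psi] is relabelled so that its heights run in the order of [y], which yields
   [psi_incr]. *)
have [c|sigma sigma_incr] := @fin_all_exists E' (fun=> W -> W) (fun c s =>
    forall w w', y w < y w' -> enum_rank (psi c (s w)) < enum_rank (psi c (s w'))).
  apply: (@increasing_relabelling W y (fun w => enum_rank (psi c w))) => //.
  by move=> w w' /val_inj/enum_rank_inj/psi_inj.
have sigma_inj c : injective (sigma c).
  move=> w w' ss; apply: y_inj.
  by case: (ltngtP (y w) (y w')) => // /(sigma_incr c); rewrite ss ltnn.
pose psi' c := psi c \o sigma c.
have psi'_inj c : injective (psi' c) by exact: inj_comp.
exists (tutte_vertex W V E'), (tutte_edge W E E'), (tutte_graph phi psi'),
  (tutte_x x (fun c => enum_rank c) (\max_w x w).+1),
  (tutte_y psi' (fun v => enum_rank v) (fun c => enum_rank c) #|E'|); split.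
- exact: tutte_graph_inj.
- apply: tutte_y_inj => //.
  + by move=> v v' /val_inj/enum_rank_inj.
  + by move=> v v' /val_inj/enum_rank_inj.
- apply: tutte_graph_box phi_box => //.
  + by move=> w; rewrite ltnS; exact: leq_bigmax.
  + by move=> v v' /val_inj/enum_rank_inj.
  + by move=> v v' /val_inj/enum_rank_inj.
- apply: tutte_girth => //.
  apply: (girth_ge_image (a := id) (b := id) _ _ _ Hpsi) => // v c [w <-].
  by exists (psi' c w), c; split=> //; exists (sigma c w).
- apply: tutte_not_colorable => // f; have [c [i ci]] := psi_col f.
  by exists c, i => w; exact: ci.
Qed.

(** * Graph cycles as leafless sets *)

Lemma next_neq (T : eqType) (s : seq T) (w : T) :
  uniq s -> 3 <= size s -> w \in s ->
  next s w <> w /\ next s (next s w) <> w.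
Proof.
move=> us s3 ws; have [i s' rs] := rot_to ws.
rewrite -!(next_rot i us) rs.
have: 3 <= size (w :: s') by rewrite -rs size_rot.
have: uniq (w :: s') by rewrite -rs rot_uniq.
case: s' rs => [|a [|b s']] //= _; rewrite !inE !negb_or.
move=> /andP[/and3P[wa wb _] _] _; rewrite eqxx.
rewrite eq_sym (negPf wa) eqxx.
by split=> /eqP; rewrite eq_sym ?(negPf wa) ?(negPf wb).
Qed.

(** The vertices of the cycle, each paired with its two cycle edges, form a leafless set of at most
    [2 * size s] incidences. *)
Lemma girth_ge_cycle (N W E : finType) (phi : E -> N -> W) (adj : rel W) g s :
  (forall w w', adj w w' ->
    exists e, forall v, incident phi v e <-> v = w \/ v = w') ->
  girth_ge g.*2 (incident phi) -> 3 <= size s -> ucycle adj s -> g <= size s.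
Proof.
move=> adjP Hphi s3 /andP[cs us]; rewrite leqNgt; apply/negP => sg.
have adjn w : w \in s -> exists e, forall v,
    incident phi v e <-> v = w \/ v = next s w.
  by move=> ws; apply/adjP/next_cycle.
have [w0 w0s] : exists w0, w0 \in s.
  by case: s s3 {cs us sg adjn} => // w s _; exists w; exact: mem_head.
have [e0 _] := adjn w0 w0s.
have [w|eps epsP] := @fin_all_exists W (fun=> E) (fun w e => w \in s ->
    forall v, incident phi v e <-> v = w \/ v = next s w).
  have [/adjn[e eP]|ws] := boolP (w \in s); first by exists e.
  by exists e0.
(* [w] lies on [eps w] but, since the cycle has length at least 3, not on [eps (next s w)]. *)
have eps_next w : w \in s -> eps (next s w) <> eps w.
  move=> ws ee; have [nw nnw] := next_neq us s3 ws.
  have: incident phi w (eps w) by apply/epsP => //; left.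
  by rewrite -ee => /epsP[|/esym|/esym]; rewrite ?mem_next.
pose S := [set (w, eps w) | w in s] :|: [set (next s w, eps w) | w in s].
suff S0 : S = set0.
  by have : (w0, eps w0) \in S by [rewrite inE imset_f]; rewrite S0 inE.
apply: Hphi.
- by move=> _ /setUP[]/imsetP[w ws ->]; apply/epsP => //; [left|right].
- move=> _ /setUP[]/imsetP[w ws ->].
    have [nw nnw] := next_neq us s3 ws; split.
      exists (w, eps (prev s w)); split=> //=.
        apply/setUP; right; apply/imsetP.
        exists (prev s w); first by rewrite mem_prev.
        by rewrite next_prev.
      by have := eps_next (prev s w); rewrite mem_prev next_prev // => /(_ ws)/nesym.
    exists (next s w, eps w); split=> //.
    by rewrite inE (imset_f (fun w => (next s w, eps w))) ?orbT.
  have [nw nnw] := next_neq us s3 ws; split.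
    exists (next s w, eps (next s w)); split=> //=; last exact: eps_next.
    by rewrite inE (imset_f (fun w => (w, eps w))) ?mem_next.
  exists (w, eps w); split=> //=; last exact: nesym.
  by rewrite inE (imset_f (fun w => (w, eps w))).
- apply: leq_ltn_trans (leq_card_setU _ _) _.
  rewrite -addnn -addSn; apply: leq_add.
    apply: leq_ltn_trans (leq_imset_card _ _) _.
    exact: leq_ltn_trans (card_size s) sg.
  apply: leq_trans (leq_imset_card _ _) _.
  exact: leq_trans (card_size s) (ltnW sg).
Qed.

From mathcomp Require Import all_order all_algebra.
From mathcomp Require Import all_classical all_reals all_analysis.

Import Order.TTheory GRing.Theory Num.Theory.
Local Open Scope classical_set_scope.
Local Open Scope ring_scope.

(** * Realization by points and rectangles *)

Section PlaneRealization.
Variables (R : realType) (W E : finType) (phi : E -> bool -> W) (x y : W -> nat).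
Hypothesis phi_inj : forall e, injective (phi e).
Hypothesis y_inj : injective y.
Hypothesis phi_box : forall e w,
  in_box x y (phi e true) (phi e false) w -> incident phi w e.

Definition point (w : W) : R * R := ((x w)%:R, (y w)%:R).

Definition box (e : E) : set (R * R) :=
  let p := phi e true in let q := phi e false in
  rectangle (minn (x p) (x q))%:R (maxn (x p) (x q))%:R
            (minn (y p) (y q))%:R (maxn (y p) (y q))%:R.

Definition box_graph := trace_hypergraph (range point) (range box).

Lemma point_inj : injective point.
Proof. by move=> v w [_ /eqP]; rewrite eqr_nat => /eqP/y_inj. Qed.

Lemma boxE e w : box e (point w) <-> incident phi w e.
Proof.
rewrite /box /rectangle /= !ler_nat; split=> [[xB yB]|[b <-]].
  by apply: phi_box; rewrite /in_box xB yB.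
by case: b; rewrite ?geq_minl ?geq_minr ?leq_maxl ?leq_maxr.
Qed.

Lemma trace_box e :
  range point `&` box e = [set point (phi e true); point (phi e false)].
Proof.
apply/seteqP; split=> [_ [[w _ <-] /boxE[[] <-]]|_ [] ->].
- by left.
- by right.
- by split; [exists (phi e true) | apply/boxE; exists true].
- by split; [exists (phi e false) | apply/boxE; exists false].
Qed.

Lemma box_graph_is_graph : is_graph box_graph.
Proof.
move=> _ [_ [e _ <-] <-]; rewrite trace_box; apply/eq_cardSP.
exists (point (phi e true)); first by left.
suff -> : [set point (phi e true); point (phi e false)] `\ point (phi e true) =
    [set point (phi e false)] by exact: card_set1.
apply/seteqP; split=> [p [[] // -> /(_ erefl)] //|_ ->]; split; first by right.
by move=> /point_inj/phi_inj.
Qed.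

Lemma box_graph_girth g :
  girth_ge g.*2 (incident phi) -> ((g%:R)%:E <= girth R box_graph)%E.
Proof.
move=> Hphi; apply: le_ereal_inf_tmp => _ [s [s3 cs] <-]; rewrite lee_fin ler_nat.
(* Points of a cycle lie on edges, hence in [range point], so the cycle lifts to [W]. *)
have [s' sE] : exists s', s = map point s'.
  have: forall p, p \in s -> range point p.
    move=> p ps; move/andP: cs => [/next_cycle/(_ ps)/asboolP H _].
    by apply: (edges_sub H); left.
  elim: (s) => [|p t IHt] sP; first by exists [::].
  have [|t' ->] := IHt; first by move=> q qt; apply: sP; rewrite inE qt orbT.
  by have [w _ <-] := sP p (mem_head _ _); exists (w :: t').
move: s3 cs; rewrite sE size_map => s3 cs.
apply: (@girth_ge_cycle _ _ _ _ (relpre point (Defs.adjacent box_graph))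
  _ _ _ Hphi) => //.
  move=> w w' /asboolP[_ [e _ <-] eE]; exists e => v.
  split=> [/boxE ve|vw].
    have : (range point `&` box e) (point v) by split=> //; exists v.
    by rewrite eE => -[/point_inj->|/point_inj->]; [left|right].
  apply/boxE; have : [set point w; point w'] (point v).
    by case: vw => ->; [left|right].
  by rewrite -eE => -[].
move: cs => /andP[cs us]; rewrite /ucycle /ucycleb.
by rewrite -cycle_map cs -(map_inj_uniq point_inj).
Qed.

Lemma box_graph_chromatic_number k :
  not_colorable k phi -> (((k.+1)%:R)%:E <= chromatic_number R box_graph)%E.
Proof.
move=> col; apply: le_ereal_inf_tmp => _ [l [f [fl fe]] <-]; rewrite lee_fin ler_nat.
rewrite ltnNge; apply/negP => lk.
have fk w : (f (point w) < k)%N by apply: leq_trans lk; apply: fl; exists w.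
have [e [i ei]] := col (fun w => Ordinal (fk w)).
apply: (fe (range point `&` box e)); first by exists (box e) => //; exists e.
by exists i => _ [[w _ <-] /boxE[b <-]]; rewrite -(ei b).
Qed.

End PlaneRealization.

Theorem theorem3 (R : realType) (c g : nat) (hc : (1 <= c)%N) (hg : (1 <= g)%N) :
  exists (P : set (R * R)) (F : set (set (R * R))),
    [/\ finite_set P, finite_set F & F `<=` @axis_parallel_rectangle R] /\
    [/\ is_graph (trace_hypergraph P F),
        ((g%:R)%:E <= girth R (trace_hypergraph P F))%E &
        ((c.+1%:R)%:E <= chromatic_number R (trace_hypergraph P F))%E].
Proof.
have [W [E [phi [x [y [phi_inj y_inj phi_box Hphi phi_col]]]]]] :=
  high_girth_box_graph c g.
exists (range (@point R W x y)), (range (@box R W E phi x y)); split; split.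
- exact/finite_image/finite_finset.
- exact/finite_image/finite_finset.
- by move=> _ [e _ <-]; do 4 eexists.
- exact: box_graph_is_graph.
- exact: box_graph_girth.
- exact: box_graph_chromatic_number.
Qed.
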